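(* For every integer $d\ge1$ there is a constant $c_d>0$, and there is an absolute constant $c>0$ such that one may take $c_d=d^{-c d^2}$ for every $d\ge2$, with the following property. Let $X_1,\dots,X_{2d}\subset\mathbb R^d$. Suppose that for every $i\in\{1,\dots,2d\}$ there is an invertible linear operator $A_i$ on $\mathbb R^d$ such that $$A_i\mathbf B^d\subset\operatorname{conv}X_i,\qquad |\det A_i|\ge1.$$ Then there are a rainbow set $R$ (with respect to $X_1,\dots,X_{2d}$) and an invertible linear operator $A$ on $\mathbb R^d$ with $$A\mathbf B^d\subset\operatorname{conv}R,\qquad |\det A|\ge c_d.$$
   Context: $\mathbf B^d$ is the closed Euclidean unit ball of $\mathbb R^d$ centered at the origin, and $\operatorname{conv}$ is the convex hull. A rainbow set with respect to $X_1,\dots,X_{2d}$ contains at most one member from each $X_i$; members with the same geometric position but different color labels are treated as distinct (so a rainbow set is $\{x_i: i\in I\}$ with $I\subset\{1,\dots,2d\}$ and $x_i\in X_i$ for $i\in I$). *)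

(* Defs.v *)
From HB Require Import structures.
From mathcomp Require Import all_boot all_order all_algebra.
From mathcomp Require Import boolp classical_sets reals exp convex.

Set Implicit Arguments.
Unset Strict Implicit.
Unset Printing Implicit Defensive.

Import Order.TTheory GRing.Theory Num.Theory.

Local Open Scope classical_set_scope.
Local Open Scope ring_scope.

(* The norm `|x| that the library puts on matrices is the sup norm, hence the
   separate Euclidean norm. *)
Definition l2norm (R : realType) (d : nat) (x : 'cV[R]_d) : R :=
  Num.sqrt (\sum_(i < d) x i ord0 ^+ 2).

Definition l2ball (R : realType) (d : nat) : set 'cV[R]_d :=
  [set x | l2norm x <= 1].

Definition conv_hull (R : realType) (V : lmodType R) (X : set V) : set V :=
  smallest (@convex_set R V) X.

(* A colour set I and a choice of one point x i in each X i with i in I. Points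
   of different colours may coincide; the values of x outside I are junk. *)
Definition rainbow (T : Type) (n : nat) (X : 'I_n -> set T) (S : set T) : Prop :=
  exists (I : set 'I_n) (x : 'I_n -> T),
    (forall i, I i -> X i (x i)) /\ S = [set x i | i in I].

(* Main.v *)
Require Import Defs.
From HB Require Import structures.
From mathcomp Require Import all_boot all_order all_algebra.
From mathcomp Require Import interval_inference boolp classical_sets reals exp convex.
From mathcomp Require Import ring lra zify.

Set Implicit Arguments.
Unset Strict Implicit.
Unset Printing Implicit Defensive.

Import Order.TTheory GRing.Theory Num.Theory.

Local Open Scope classical_set_scope.
Local Open Scope ring_scope.

(* Each colour contributes a finite "balanced" family Y_i of vectors a x with
   x in X_i and 0 <= a <= 1, obtained by writing the points A_i e_c and
   - A_i e_c as convex combinations (Caratheodory); balanced means that the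
   family sums to 0. Among all rainbow d-tuples from the Y_i take one, V, with
   the largest |det V|. A greedy elimination gives a rainbow d-tuple W from the
   other d colours with |det W| >= 1 / (d! (d+1)^d).

   If Y_1, ..., Y_d are balanced in R^d, the sum of |det v| over all rainbow
   tuples v whose cone contains b does not depend on the generic point b: when
   b crosses the facet opposite to v_i, the determinants of the tuples on both
   sides cancel because the i-th family sums to 0. Comparing b in the interior of
   the cone of V with b = - sum W gives a rainbow tuple v, in the colours of V,
   whose cone contains - sum W and whose determinant is comparable to det V.
   By Cramer's rule and the maximality of V the coefficients of - sum W in v
   are at most d^O(d), so the hull of v and W contains the image of the unit
   ball under d^-O(d) W. *)

(** * Generic segments and the positive orthant *)

Section Crossing.
Variables (F : realFieldType) (T : finType).
Implicit Types p q : T -> F.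

(* The segment from p to q enters the positive orthant through the facet i: the
   conditions on j say that the other coordinates are positive at the point
   where the i-th one vanishes. *)
Definition enters p q i :=
  [&& p i < 0, 0 < q i & [forall j, (j != i) ==> (0 < p j * q i - p i * q j)]].

(** The last condition keeps the line through [p] and [q] off the intersections of two coordinate
    hyperplanes. *)
Definition generic_pair p q :=
  [/\ forall i, p i != 0, forall i, q i != 0
    & forall i j, i != j -> p i * q j != q i * p j].

Lemma generic_pair_sym p q : generic_pair p q -> generic_pair q p.
Proof. by case=> hp hq h; split=> // i j /h; rewrite eq_sym. Qed.

Lemma enters_uniq p q i j : enters p q i -> enters p q j -> i = j.
Proof.
case/and3P=> _ _ /forallP /(_ j) hi /and3P[_ _ /forallP /(_ i) hj].
apply/eqP; apply: contraTT hi => neq; rewrite eq_sym neq /=.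
by move: hj; rewrite neq /=; rewrite -!leNgt => h; lra.
Qed.

(** From [p] to [q], the facet of exit belongs to the first coordinate positive at [p] that
    vanishes; it minimizes [q i / p i]. By the last hypothesis, the coordinates negative at [p] are
    positive by then. *)
Lemma exists_exit p q : generic_pair p q ->
  (exists j, (0 < p j) && (q j < 0)) ->
  (forall m j, p m < 0 -> 0 < p j -> p m * q j < p j * q m) ->
  exists i, enters q p i.
Proof.
move=> [p0 q0 pq] [j0 /andP[pj0 qj0]] H.
pose i := [arg min_(i < j0 | 0 < p i) (q i / p i)]%O.
have [pi ile] : 0 < p i /\ forall j, 0 < p j -> q i / p i <= q j / p j.
  by rewrite /i; case: arg_minP.
have qi : q i < 0.
  have := ile _ pj0; rewrite ler_pdivrMr // => h; apply: (le_lt_trans h).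
  by rewrite pmulr_llt0 // pmulr_llt0 // invr_gt0.
exists i; rewrite /enters qi pi /=; apply/forallP=> m; apply/implyP=> mi.
rewrite subr_gt0; have [pm|pm|pm] := ltgtP (p m) 0.
- by have := H _ _ pm pi; rewrite mulrC [X in _ < X]mulrC.
- rewrite lt_neqAle; apply/andP; split.
    by rewrite eq_sym mulrC; apply: pq; rewrite eq_sym.
  by have := ile _ pm; rewrite ler_pdivrMr // mulrAC ler_pdivlMr.
- by have := p0 m; rewrite pm eqxx.
Qed.

(** At the entry point no coordinate is negative and only the [i]-th vanishes, so the coordinates
    negative at [p] change sign before one positive at [p] vanishes, as [exists_exit] requires. *)
Lemma enters_exit p q : generic_pair p q -> (exists j, ~~ (0 < q j)) ->
  (exists i, enters p q i) -> exists i, enters q p i.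
Proof.
move=> gpq [j qj] [i /and3P[pi qi /forallP hi]].
have [p0 q0 _] := gpq.
have H m : m != i -> p i * q m < p m * q i.
  by move=> mi; have := hi m; rewrite mi subr_gt0.
have {}qj : q j < 0 by rewrite lt_neqAle q0 leNgt.
have ji : j != i by apply: contraTneq qj => ->; rewrite -leNgt ltW.
have pj : 0 < p j.
  have := H _ ji; have h : 0 < p i * q j by rewrite nmulr_rgt0.
  by move/(lt_trans h); rewrite pmulr_lgt0.
apply: exists_exit => //; first by exists j; rewrite pj.
move=> m k pm pk.
have ki : k != i by apply: contraTneq pk => ->; rewrite -leNgt ltW.
have [->|mi] := eqVneq m i; first exact: H.
have hm := H _ mi; have hk := H _ ki.
(* After multiplication by [q i], the difference is a combination of the gaps in [hk] and [hm]. *)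
rewrite -(ltr_pM2r qi) -subr_gt0.
have -> : p k * q m * q i - p m * q k * q i =
  (p k * q i - p i * q k) * q m + (p i * q m - p m * q i) * q k by ring.
have qm : 0 < q m.
  have : p m * q i < 0 by rewrite pmulr_llt0.
  by move=> h; have := lt_trans hm h; rewrite nmulr_rlt0.
have [qk|qk] := leP (q k) 0.
  apply: ltr_wpDr; first by rewrite mulr_le0 // subr_le0 ltW.
  by rewrite mulr_gt0 // subr_gt0.
have -> : (p k * q i - p i * q k) * q m + (p i * q m - p m * q i) * q k =
  (p k * q m - p m * q k) * q i by ring.
by rewrite mulr_gt0 // subr_gt0; apply: lt_trans (_ : 0 < _);
  rewrite ?mulr_gt0 // nmulr_rlt0.
Qed.

(** A segment enters the orthant at most once and leaves it at most once, so each sum is 0 or 1; if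
    both ends are outside, the two agree by [enters_exit]. *)
Lemma all_pos_jump p q : generic_pair p q ->
  [forall i, 0 < q i]%:R - [forall i, 0 < p i]%:R =
  \sum_i ((enters p q i)%:R - (enters q p i)%:R) :> F.
Proof.
move=> gpq; have gqp := generic_pair_sym gpq; have [p0 q0 _] := gpq.
have sum_ex r s : \sum_i (enters r s i)%:R = [exists i, enters r s i]%:R :> F.
  case: existsP => [[i ei]|ne]; last first.
    by rewrite big1 // => i _; case: (boolP (enters r s i)) => // h; case: ne; exists i.
  rewrite (bigD1 i) //= ei big1 ?addr0 // => j ji.
  by case: (boolP (enters r s j)) => // /(enters_uniq ei) E; rewrite E eqxx in ji.
rewrite sumrB !sum_ex.
have noent r s : (forall i, 0 < r i) -> [exists i, enters r s i] = false.
  move=> h; apply/negbTE/existsPn=> i; apply/negP=> /and3P[].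
  by rewrite ltNge (ltW (h i)).
have ent r s : generic_pair r s -> (forall i, 0 < r i) -> ~~ [forall i, 0 < s i] ->
    [exists i, enters s r i].
  move=> g h /forallPn[j sj]; have [_ s0 _] := g; apply/existsP; apply: (exists_exit g).
    by exists j; rewrite h lt_neqAle leNgt sj s0.
  by move=> m k; rewrite ltNge (ltW (h m)).
have [/forallP hq|nq] := boolP [forall i, 0 < q i];
  have [/forallP hp|np] := boolP [forall i, 0 < p i].
- by rewrite !noent // !subrr.
- by rewrite (noent q) // (ent q).
- by rewrite (noent p) // (ent p).
have -> : [exists i, enters p q i] = [exists i, enters q p i]; last by rewrite !subrr.
apply/existsP/existsP; apply: enters_exit => //; apply/existsP.
  by rewrite -negb_forall.
by rewrite -negb_forall.
Qed.

End Crossing.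

(** * Generic perturbation of a point *)

Section Perturbation.
Variable F : realFieldType.

Lemma non_root_exists (p : {poly F}) : p != 0 -> exists x, p.[x] != 0.
Proof.
move=> p0; pose rs := [seq i%:R : F | i <- iota 0 (size p)].
have /allPn[x _ px] : ~~ all (root p) rs.
  apply/negP=> h; have := max_poly_roots p0 h.
  rewrite size_map size_iota ltnn map_inj_uniq ?iota_uniq => [/(_ isT) //|].
  by move=> i j /eqP; rewrite eqr_nat => /eqP.
by exists x.
Qed.

(** For [z] on the moment curve (1, x, x^2, ...), each pairing is a nonzero polynomial in x; take x
    off the roots of the product. *)
Lemma generic_point d (J : finType) (u : J -> 'cV[F]_d) :
  (forall j, u j != 0) -> exists z : 'rV_d, forall j, (z *m u j) 0 0 != 0.
Proof.
move=> u0; pose p j := rVpoly (u j)^T.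
have p0 j : p j != 0.
  apply: contra_neq (u0 j) => pj0.
  by rewrite -[u j]trmxK -[(u j)^T]rVpolyK -/(p j) pj0 linear0 trmx0.
have [x] : exists x, (\prod_j p j).[x] != 0.
  by apply: non_root_exists; apply/prodf_neq0.
rewrite horner_prod => /prodf_neq0 px.
exists (\row_i x ^+ i) => j; have := px j isT.
rewrite /p /rVpoly horner_poly mxE.
suff -> : \sum_(i < d) (\row_i0 x ^+ i0) 0 i * u j i 0 =
  \sum_(i < d) oapp ((u j)^T 0) 0 (insub (val i)) * x ^+ i by [].
by apply: eq_bigr => i _; rewrite valK /= !mxE mulrC.
Qed.

Lemma generic_perturbation d (J : finType) (u : J -> 'cV[F]_d) (b : 'rV_d) :
  (forall j, u j != 0) ->
  exists b' : 'rV_d, forall j,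
    (b' *m u j) 0 0 != 0 /\
    ((b *m u j) 0 0 != 0 -> 0 < (b *m u j) 0 0 * (b' *m u j) 0 0).
Proof.
move=> /generic_point[z zu].
pose B j := (b *m u j) 0 0; pose Z j := (z *m u j) 0 0.
(* Adding [s^-1 *: z] is too small a change to alter a nonzero sign. A zero [B j] contributes 0 to
   the sum, the inverse of 0 being 0. *)
pose s := 1 + \sum_j `|Z j| / `|B j|.
have s_ge j : `|Z j| / `|B j| < s.
  by rewrite /s (bigD1 j) //= addrCA ltrDl ltr_pwDl // sumr_ge0 // => k _; rewrite divr_ge0.
have s0 : 0 < s by rewrite ltr_pwDl // sumr_ge0 // => k _; rewrite divr_ge0.
exists (b + s^-1 *: z) => j.
have -> : ((b + s^-1 *: z) *m u j) 0 0 = B j + s^-1 * Z j.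
  by rewrite mulmxDl -scalemxAl mxE [X in _ + X]mxE.
have [Bj|Bj] := eqVneq (B j) 0.
  split=> //.
  by rewrite Bj add0r mulf_eq0 invr_eq0 gt_eqF //=; apply: zu.
have lt : `|s^-1 * Z j| < `|B j|.
  rewrite normrM gtr0_norm ?invr_gt0 // mulrC ltr_pdivrMr //.
  by rewrite mulrC -ltr_pdivrMr ?normr_gt0.
have pos : 0 < B j * (B j + s^-1 * Z j).
  have [B0|B0] := ltP 0 (B j).
    by rewrite pmulr_rgt0 //; move: lt; rewrite ltr_norml (gtr0_norm B0); lra.
  have {}B0 : B j < 0 by rewrite lt_neqAle Bj.
  by rewrite nmulr_rgt0 //; move: lt; rewrite ltr_norml (ltr0_norm B0); lra.
split=> // ; by apply: contraTneq pos => ->; rewrite mulr0 ltxx.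
Qed.

End Perturbation.

(** * Averages, and determinants with one row replaced *)

Lemma exists_ge_average (F : realFieldType) (T : finType) (t : T -> F) (c : F) :
  0 < c -> c <= \sum_k t k -> exists k, c <= #|T|%:R * t k.
Proof.
move=> c0 hc; apply/existsP; apply: contraTT hc => /existsPn lt; rewrite -ltNge.
have [k _|T0] := pickP (@predT T); last by rewrite big_pred0.
have T0 : 0 < #|T|%:R :> F by rewrite ltr0n; apply/card_gt0P; exists k.
have E : \sum_(k : T) c / #|T|%:R = c.
  by rewrite sumr_const -[LHS]mulr_natr divfK ?gt_eqF.
rewrite -[X in _ < X]E; apply: ltr_sum => [|j _].
  by apply/hasP; exists k; rewrite ?mem_index_enum.
by rewrite ltr_pdivlMr // mulrC; have := lt j; rewrite -ltNge.
Qed.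

Definition set_row (F : Type) d (i : 'I_d) (v : 'rV[F]_d) (M : 'M[F]_d) : 'M[F]_d :=
  \matrix_(r, s) if r == i then v 0 s else M r s.

Lemma det_set_row (F : comPzRingType) d i (v : 'rV[F]_d) (M : 'M[F]_d) :
  \det (set_row i v M) = (v *m \adj M) 0 i.
Proof.
rewrite (expand_det_row _ i) mxE; apply: eq_bigr => j _.
rewrite !mxE eqxx /cofactor; congr (_ * (_ * \det _)).
by apply/matrixP=> r s; rewrite !mxE eq_sym (negbTE (neq_lift _ _)).
Qed.

(** Cramer's rule, free of division. *)
Lemma det_set_row_mul (F : comPzRingType) d i (l : 'rV[F]_d) (M : 'M[F]_d) :
  \det (set_row i (l *m M) M) = l 0 i * \det M.
Proof. by rewrite det_set_row -mulmxA mul_mx_adj mul_mx_scalar mxE mulrC. Qed.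

(** * Rainbow cones of balanced families *)

Section Balanced.
Variables (F : realFieldType) (d : nat) (K : finType) (y : 'I_d -> K -> 'rV[F]_d).
Hypothesis balanced : forall i, \sum_k y i k = 0.
Implicit Types (k : {ffun 'I_d -> K}) (b : 'rV[F]_d).

Let M k : 'M[F]_d := \matrix_i y i (k i).
Let D k := \det (M k).
Let coord k b := b *m invmx (M k).
(** The numerator of the [i]-th coordinate in Cramer's rule; it does not depend on [k i]. *)
Let P k i b := \det (set_row i b (M k)).
Let upd i k m : {ffun 'I_d -> K} := [ffun j => if j == i then m else k j].

Let coordE k b i : D k != 0 -> coord k b 0 i = P k i b / D k.
Proof.
move=> Dk; have uM : M k \in unitmx by rewrite unitmxE unitfE.
by rewrite /coord /invmx uM -scalemxAr mxE mulrC /P det_set_row.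
Qed.

Let P_upd i k m b : P (upd i k m) i b = P k i b.
Proof.
congr (\det _); apply/matrixP=> r s; rewrite !mxE ffunE.
by case: eqP.
Qed.

Let D_upd i k m : D (upd i k m) = P k i (y i m).
Proof.
congr (\det _); apply/matrixP=> r s; rewrite !mxE ffunE.
by case: eqP => // ->.
Qed.

Let sum_D_upd i k : \sum_m D (upd i k m) = 0.
Proof.
under eq_bigr do rewrite D_upd /P det_set_row.
by rewrite -summxE -mulmx_suml balanced mul0mx mxE.
Qed.

(** The tuples are grouped by their entries off [i]. Instead of a quotient, the sum is taken [#|K|]
    times and the pairs (k, m) are permuted by the involution [h] that exchanges [k i] with [m]. *)
Let sum_upd i (f : {ffun 'I_d -> K} -> F) :
  (forall k, \sum_m f (upd i k m) = 0) -> \sum_k f k = 0.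
Proof.
move=> f0; have [m _|K0] := pickP (@predT K); last first.
  by rewrite big1 // => k _; have := K0 (k i).
apply/eqP; have : #|K|%:R * (\sum_k f k) == 0; last first.
  by rewrite mulf_eq0 pnatr_eq0 -leqn0 leqNgt (introT card_gt0P) //; exists m.
apply/eqP; rewrite mulr_natl -sumr_const.
transitivity (\sum_k \sum_m f (upd i k m)); last by apply: big1.
rewrite exchange_big !pair_bigA /=.
pose h (x : {ffun 'I_d -> K} * K) := (upd i x.1 x.2, x.1 i).
have hK : involutive h.
  case=> k l; rewrite /h /=; congr (_, _); last by rewrite ffunE eqxx.
  by apply/ffunP=> j; rewrite !ffunE; case: eqP => [->|].
rewrite (reindex h) /=; last by exists h => x _; apply: hK.
by apply: eq_big => // [[k l]].
Qed.

(** A point with vanishing [i]-th coordinate is a combination of the other rows, which [upd]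
    keeps. *)
Let coord_upd i k m b : D k != 0 -> D (upd i k m) != 0 -> coord k b 0 i = 0 ->
  coord (upd i k m) b = coord k b.
Proof.
move=> Dk Dm ci0.
have uM : M k \in unitmx by rewrite unitmxE unitfE.
have uM' : M (upd i k m) \in unitmx by rewrite unitmxE unitfE.
rewrite -[RHS](mulmxK uM'); congr (_ *m _); rewrite -{1}(mulmxKV uM b) -/(coord k b).
apply/rowP=> j; rewrite mxE [RHS]mxE; apply: eq_bigr => l _.
rewrite [M k l j]mxE [M (upd i k m) l j]mxE ffunE.
by case: eqP => [->|//]; rewrite ci0 !mul0r.
Qed.

Let N b := \sum_k `|D k| * [forall i, 0 < coord k b 0 i]%:R.

(* Up to the factor sg (D k), the signed crossing of the facet i by the segment
   from b0 to b1; it is expressed so as not to depend on the vector k i. *)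
Let theta b0 b1 k i : F := Num.sg (P k i b1) *
  ((P k i b0 * P k i b1 < 0) &&
   [forall j, (j != i) ==>
      (0 < Num.sg (P k i b1) * coord k (P k i b1 *: b0 - P k i b0 *: b1) 0 j)])%:R.

(** The combination of [b0] and [b1] inside [theta] lies in the span of the rows other than [i], so
    [coord_upd] applies to it. *)
Let theta_upd b0 b1 k i m : D k != 0 -> D (upd i k m) != 0 ->
  theta b0 b1 (upd i k m) i = theta b0 b1 k i.
Proof.
move=> Dk Dm; rewrite /theta !P_upd coord_upd //.
rewrite coordE // {1}/P det_set_row mulmxBl -!scalemxAl.
have -> (a c : F) (u v : 'rV[F]_d) : (a *: u - c *: v) 0 i = a * u 0 i - c * v 0 i.
  by rewrite !mxE.
by rewrite -!det_set_row -/(P k i b0) -/(P k i b1) [_ * P k i b1]mulrC subrr mul0r.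
Qed.

Let sum_theta b0 b1 i : \sum_k D k * theta b0 b1 k i = 0.
Proof.
apply: (@sum_upd i) => k /=.
have [m0 Dm0|D0] := pickP (fun m => D (upd i k m) != 0); last first.
  by rewrite big1 // => m _; have /negbFE/eqP/= -> := D0 m; rewrite mul0r.
(* [theta] is constant where [D] is nonzero, and its value elsewhere is multiplied by 0; balance
   then kills the sum. *)
transitivity (\sum_m D (upd i k m) * theta b0 b1 (upd i k m0) i); last first.
  by rewrite -mulr_suml sum_D_upd mul0r.
apply: eq_bigr => m _; have [->|Dm] := eqVneq (D (upd i k m)) 0; first by rewrite !mul0r.
have E : upd i k m = upd i (upd i k m0) m.
  by apply/ffunP=> j; rewrite !ffunE; case: eqP.
by rewrite {2}E theta_upd // -E.
Qed.

(** The orientation of the tuple sits in the sign of [P]: [sg (P k i b1)] contributes [sg (D k)],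
    which turns [D k] into its absolute value. *)
Let enters_theta b0 b1 k i : D k != 0 ->
  `|D k| * ((enters (coord k b0 0) (coord k b1 0) i)%:R -
            (enters (coord k b1 0) (coord k b0 0) i)%:R) = D k * theta b0 b1 k i.
Proof.
move=> Dk; rewrite /theta.
have PE b : P k i b = D k * coord k b 0 i by rewrite coordE // mulrCA divff // mulr1.
rewrite !PE; set p := coord k b0 0; set q := coord k b1 0.
have -> : (D k * p i * (D k * q i) < 0) = (p i * q i < 0).
  by rewrite mulrACA pmulr_rlt0 // -expr2 exprn_even_gt0.
have condE j : (0 < Num.sg (D k * q i) *
    coord k ((D k * q i) *: b0 - (D k * p i) *: b1) 0 j) =
    (0 < Num.sg (q i) * (p j * q i - p i * q j)).
  have -> : coord k ((D k * q i) *: b0 - (D k * p i) *: b1) 0 j =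
      D k * (p j * q i - p i * q j).
    rewrite /coord mulmxDl mulNmx -!scalemxAl -/(coord k b0) -/(coord k b1).
    have -> (u v : 'rV[F]_d) a c : (a *: u - c *: v) 0 j = a * u 0 j - c * v 0 j.
      by rewrite !mxE.
    by rewrite -/(p j) -/(q j); ring.
  by rewrite sgrM mulrACA -normrEsg [LHS]pmulr_rgt0 ?normr_gt0.
under eq_forallb => j do rewrite condE.
rewrite sgrM [RHS]mulrA [in RHS]mulrA [D k * _]mulrC -normrEsg -mulrA; congr (_ * _).
rewrite /enters; have [qi|qi|qi] := ltgtP (q i) 0.
- rewrite ltr0_sg // !andbF sub0r mulN1r nmulr_llt0 //=; congr (- (_ && _)%:R).
  by apply: eq_forallb => j; rewrite mulN1r opprB [p j * _]mulrC [p i * _]mulrC.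
- rewrite gtr0_sg // !andFb subr0 mul1r pmulr_llt0 //=; congr ((_ && _)%:R).
  by apply: eq_forallb => j; rewrite mul1r.
- by rewrite qi sgr0 mul0r andbF subrr.
Qed.

Let N_const b0 b1 : (forall k, D k != 0 -> generic_pair (coord k b0 0) (coord k b1 0)) ->
  N b1 = N b0.
Proof.
move=> gen; apply/eqP; rewrite -subr_eq0 -sumrB; apply/eqP.
transitivity (\sum_k \sum_i D k * theta b0 b1 k i); last first.
  by rewrite exchange_big big1 //= => i _; apply: sum_theta.
apply: eq_bigr => k _; have [Dk|Dk] := eqVneq (D k) 0.
  by rewrite Dk normr0 !mul0r subrr big1 // => i _; rewrite mul0r.
rewrite -mulrBr all_pos_jump; last exact: gen.
by rewrite mulr_sumr; apply: eq_bigr => i _; apply: enters_theta.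
Qed.

Lemma balanced_cone (k0 : {ffun 'I_d -> K}) (b : 'rV[F]_d) :
    \det (\matrix_i y i (k0 i)) != 0 ->
  exists (k : {ffun 'I_d -> K}) (l : 'rV[F]_d),
    [/\ `|\det (\matrix_i y i (k0 i))| <=
          #|{ffun 'I_d -> K}|%:R * `|\det (\matrix_i y i (k i))|,
        \det (\matrix_i y i (k i)) != 0,
        forall i, 0 <= l 0 i
      & b = l *m \matrix_i y i (k i)].
Proof.
rewrite -/(M k0) -/(D k0) => Dk0.
have coord_col (v : 'rV[F]_d) k i : (v *m col i (invmx (M k))) 0 0 = coord k v 0 i.
  by rewrite /coord !mxE; apply: eq_bigr => j _; rewrite !mxE.
have col_neq0 k i : D k != 0 -> col i (invmx (M k)) != 0.
  move=> Dk; have uM : M k \in unitmx by rewrite unitmxE unitfE.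
  apply/eqP=> c0; have /matrixP/(_ i i) := mulmxV uM.
  rewrite [RHS]mxE eqxx => /eqP; rewrite mxE big1 ?(eq_sym 0) ?oner_eq0 // => j _.
  by have /colP/(_ j) := c0; rewrite !mxE => ->; rewrite mulr0.
pose one : 'cV[F]_d := const_mx 1.
have one0 (i : 'I_d) : one != 0.
  by apply/eqP => /colP/(_ i)/eqP; rewrite !mxE oner_eq0.
(* The facet normals of all nondegenerate cones; [one] is a nonzero filler for the degenerate
   tuples. *)
pose u0 (ki : {ffun 'I_d -> K} * 'I_d) : 'cV[F]_d :=
  if D ki.1 == 0 then one else col ki.2 (invmx (M ki.1)).
have u00 ki : u0 ki != 0.
  by rewrite /u0; case: ifP => [_|/negbT/col_neq0//]; exact: one0 ki.2.
(* [b0] is a generic point near the sum of the rows of [M k0], whose coordinates there are all 1; it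
   stays inside that cone. *)
have [b0 hb0] := generic_perturbation ((const_mx 1 : 'rV[F]_d) *m M k0) u00.
have b0_neq0 k i : D k != 0 -> coord k b0 0 i != 0.
  by move=> Dk; have [] := hb0 (k, i); rewrite /u0 /= (negbTE Dk) coord_col.
have b0_pos i : 0 < coord k0 b0 0 i.
  have [_] := hb0 (k0, i); rewrite /u0 /= (negbTE Dk0) !coord_col.
  rewrite {1 2}/coord mulmxK ?unitmxE ?unitfE // mxE oner_eq0 mul1r.
  exact.
(* With [b0] fixed, the conditions of [generic_pair] on [b1] are linear: pairing with these vectors
   must not give 0. *)
pose u1 (x : ({ffun 'I_d -> K} * 'I_d) + ({ffun 'I_d -> K} * ('I_d * 'I_d))) : 'cV[F]_d :=
  match x with
  | inl ki => u0 ki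
  | inr (k, (i, j)) => if (D k == 0) || (i == j) then one else
      coord k b0 0 i *: col j (invmx (M k)) - coord k b0 0 j *: col i (invmx (M k))
  end.
have u10 x : u1 x != 0.
  case: x => [ki|[k [i j]]] /=; first exact: u00.
  case: ifP => [_|/negbT]; first exact: one0 i.
  rewrite negb_or => /andP[Dk ij].
  have uM : M k \in unitmx by rewrite unitmxE unitfE.
  apply: contraNneq (b0_neq0 k i Dk) => /(congr1 (mulmx (M k))).
  rewrite mulmx0 mulmxBr -!scalemxAr !(colE, mulKVmx uM) => /colP/(_ j).
  have -> (a c : F) (u v : 'cV[F]_d) : (a *: u - c *: v) j 0 = a * u j 0 - c * v j 0.
    by rewrite !mxE.
  rewrite ![delta_mx _ _ _ _]mxE !eqxx (eq_sym j) (negbTE ij) mulr1 mulr0 subr0 [X in _ = X]mxE.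
  by move=> ->.
have [b1 hb1] := generic_perturbation b u10.
have gen k : D k != 0 -> generic_pair (coord k b0 0) (coord k b1 0).
  move=> Dk; split=> [i|i|i j ij]; first exact: b0_neq0.
    by have [] := hb1 (inl (k, i)); rewrite /= /u0 /= (negbTE Dk) coord_col.
  have [] := hb1 (inr (k, (i, j))); rewrite /= (negbTE Dk) (negbTE ij) /=.
  rewrite mulmxBr -!scalemxAr.
  have -> (a c : F) (u v : 'M[F]_1) : (a *: u - c *: v) 0 0 = a * u 0 0 - c * v 0 0.
    by rewrite !mxE.
  by rewrite !coord_col subr_eq0 [coord k b0 0 j * _]mulrC.
have lb : `|D k0| <= N b1.
  rewrite (N_const gen) /N (bigD1 k0) //=.
  have /forallP-> : forall i, 0 < coord k0 b0 0 i by [].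
  by rewrite mulr1 lerDl sumr_ge0 // => k _; rewrite mulr_ge0.
have D0 : 0 < `|D k0| by rewrite normr_gt0.
have [k hk] := exists_ge_average D0 lb.
have : 0 < #|{ffun 'I_d -> K}|%:R * (`|D k| * [forall i, 0 < coord k b1 0 i]%:R).
  exact: lt_le_trans D0 hk.
case: (boolP [forall i, _]) hk => [/forallP pos|_]; last by rewrite !mulr0 ltxx.
rewrite mulr1 => hk _.
have Dk : D k != 0 by apply: contraTneq D0 => Dk; move: hk; rewrite Dk normr0 mulr0 leNgt.
exists k, (coord k b); split=> // [i|]; last first.
  by rewrite mulmxKV // unitmxE unitfE.
(* A negative coordinate of [b] would stay negative at its perturbation [b1], which is inside the
   cone. *)
rewrite leNgt; apply/negP=> lt0.
have [_] := hb1 (inl (k, i)); rewrite /= /u0 /= (negbTE Dk) !coord_col.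
by move=> /(_ (ltr0_neq0 lt0)); rewrite nmulr_rgt0 // ltNge (ltW (pos i)).
Qed.

End Balanced.

(** * Rainbow tuples with a large determinant *)

Lemma det_sum_rows (F : comPzRingType) d (K : finType) (y : 'I_d -> K -> 'rV[F]_d) :
  \det (\matrix_i \sum_k y i k) =
  \sum_(k : {ffun 'I_d -> K}) \det (\matrix_i y i (k i)).
Proof.
rewrite /determinant exchange_big; apply: eq_bigr => s _ /=.
rewrite -mulr_sumr; congr (_ * _).
under eq_bigr do rewrite mxE summxE.
rewrite bigA_distr_bigA; apply: eq_bigr => k _.
by apply: eq_bigr => i _; rewrite mxE.
Qed.

Lemma det_sum_rows_pick (F : realFieldType) d (K : finType)
    (y : 'I_d -> K -> 'rV[F]_d) (c : F) :
  0 < c -> c <= `|\det (\matrix_i \sum_k y i k)| ->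
  exists k : {ffun 'I_d -> K},
    c <= #|{ffun 'I_d -> K}|%:R * `|\det (\matrix_i y i (k i))|.
Proof.
move=> c0 hc; apply: exists_ge_average c0 (le_trans hc _).
by rewrite det_sum_rows ler_norm_sum.
Qed.

(* Eliminate with the entry of largest absolute value of all the matrices as
   pivot: this costs a factor n in each dimension n. *)
Lemma rainbow_rows (F : realFieldType) n (A : 'I_n.+1 -> 'M[F]_n.+1) (c : F) :
  0 < c -> (forall j, c <= `|\det (A j)|) ->
  exists k : 'I_n.+1 -> 'I_n.+1,
    c <= (n.+1)`!%:R * `|\det (\matrix_j row (k j) (A j))|.
Proof.
elim: n A c => [|n IHn] A c c0 hA.
  exists id; apply: le_trans (hA 0) _; rewrite mul1r le_eqVlt; apply/orP; left.
  by rewrite !det_mx11 !mxE.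
pose E (x : 'I_n.+2 * ('I_n.+2 * 'I_n.+2)) := `|A x.1 x.2.1 x.2.2|.
pose x0 := [arg max_(x > (0, (0, 0))) E x]%O.
have Emax j r s : `|A j r s| <= E x0.
  by rewrite /x0; case: arg_maxP => // x _ /(_ (j, (r, s)) isT).
case: x0 Emax => j0 [r0 s0]; rewrite /E /=; set p := A j0 r0 s0 => Emax.
have p0 : p != 0.
  apply: contraTneq (hA j0) => p0; rewrite -ltNge (expand_det_col _ s0) big1 ?normr0 //.
  move=> r _; have := Emax j0 r s0; rewrite p0 normr0 normr_le0 => /eqP->.
  by rewrite mul0r.
(* The column operations that clear the pivot row of [A j0] outside column [s0]. The same [S] acts
   on every [A j] and leaves column [s0] unchanged. *)
pose S : 'M[F]_n.+2 := \matrix_(r, s)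
  if s == s0 then (r == s0)%:R else (r == s)%:R - (r == s0)%:R * (A j0 r0 s / p).
have detS : \det S = 1.
  rewrite (expand_det_col _ s0) (bigD1 s0) //= mxE !eqxx mul1r big1 ?addr0.
    rewrite /cofactor -signr_odd oddD addbb mul1r -[RHS](det1 F n.+1).
    congr (\det _); apply/matrixP=> r s; rewrite !mxE eq_sym (negbTE (neq_lift _ _)).
    by rewrite (eq_sym _ s0) (negbTE (neq_lift _ _)) mul0r subr0 (inj_eq lift_inj).
  by move=> r rs; rewrite mxE eqxx (negbTE rs) mul0r.
have det_mulS (X : 'M[F]_n.+2) : \det X = \det (X *m S).
  by rewrite det_mulmx detS mulr1.
have mulS_s0 m (X : 'M[F]_(m, n.+2)) r : (X *m S) r s0 = X r s0.
  rewrite mxE (bigD1 s0) //= mxE !eqxx mulr1 big1 ?addr0 // => s ss.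
  by rewrite mxE eqxx (negbTE ss) mulr0.
(* Expand along column [s0]: its [n.+2] entries are at most [|p|], so some minor reaches the
   average. *)
have minor j : exists r, c / (n.+2%:R * `|p|) <= `|\det (row' r (col' s0 (A j *m S)))|.
  have := hA j; rewrite det_mulS (expand_det_col _ s0).
  move=> h; have [r hr] := exists_ge_average c0 (le_trans h (ler_norm_sum _ _ _)).
  exists r; rewrite ler_pdivrMr ?mulr_gt0 ?normr_gt0 ?ltr0n // mulrC -mulrA.
  move: hr; rewrite card_ord normrM mulS_s0 => /le_trans; apply.
  rewrite ler_wpM2l // /cofactor normrM normrX normrN1 expr1n mul1r.
  by rewrite ler_wpM2r // -/p.
have /fin_all_exists[r hr] := minor.
have c1 : 0 < c / (n.+2%:R * `|p|) by rewrite divr_gt0 ?mulr_gt0 ?normr_gt0 ?ltr0n.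
have [k hk] := IHn (fun j => row' (r (lift j0 j)) (col' s0 (A (lift j0 j) *m S))) _ c1
  (fun j => hr (lift j0 j)).
(* Colour [j0] takes the pivot row; elsewhere [lift] turns a row of the minor back into a row of
   [A j]. *)
pose k1 j := if unlift j0 j is Some j' then lift (r j) (k j') else r0.
exists k1; move: hk; rewrite ler_pdivrMr ?mulr_gt0 ?normr_gt0 ?ltr0n // => /le_trans; apply.
set B := \matrix_j row (k1 j) (A j).
have -> : \det B = p * cofactor (B *m S) j0 s0.
  rewrite det_mulS (expand_det_row _ j0) (bigD1 s0) //=.
  rewrite mulS_s0 !mxE /k1 unlift_none -/p big1 ?addr0 // => s ss.
  suff -> : (B *m S) j0 s = 0 by rewrite mul0r.
  rewrite mxE (bigD1 s) //= (bigD1 s0) ?(eq_sym s0) //= big1 ?addr0 => [|t /andP[ts ts0]].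
    rewrite !mxE /k1 unlift_none (negbTE ss) !eqxx eq_sym (negbTE ss) mul0r subr0 mulr1.
    by rewrite mul1r sub0r mulrN mulrCA divff // mulr1 subrr.
  by rewrite !mxE (negbTE ss) (negbTE ts) (negbTE ts0) mul0r subr0 mulr0.
rewrite normrM /cofactor normrM normrX normrN1 expr1n mul1r (factS n.+1) natrM.
rewrite le_eqVlt; apply/orP; left; apply/eqP.
have -> : row' j0 (col' s0 (B *m S)) = \matrix_j
    row (k j) (row' (r (lift j0 j)) (col' s0 (A (lift j0 j) *m S))).
  apply/matrixP=> i s; rewrite !mxE; apply: eq_bigr => t _.
  by rewrite !mxE /k1 liftK.
by ring.
Qed.

(** * Convex hulls *)

Section ConvexHull.
Variables (R : realType) (V : lmodType R).
Implicit Types (X C S : set V).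

Lemma convex_setP C : @convex_set R V C <->
  forall x y t, 0 <= t <= 1 -> C x -> C y -> C (t *: x + (1 - t) *: y).
Proof.
split=> [cC x y t /andP[t0 t1] /mem_set Cx /mem_set Cy|cC x y l /set_mem Cx /set_mem Cy].
  exact: set_mem (cC x y (Itv01 t0 t1) Cx Cy).
by apply/mem_set/cC => //; rewrite ge0 le1.
Qed.

Lemma conv_hull_comb S (T : finType) (a : T -> R) (x : T -> V) :
  (forall i, 0 <= a i) -> \sum_i a i = 1 -> (forall i, S (x i)) ->
  conv_hull S (\sum_i a i *: x i).
Proof.
move=> a0 a1 Sx C [/convex_setP cC SC].
(* Partial sums are normalized, under the condition that their weight is positive, because initial
   weights may vanish. *)
have H s : 0 < \sum_(i <- s) a i ->
    C ((\sum_(i <- s) a i)^-1 *: \sum_(i <- s) a i *: x i).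
  elim: s => [|i s IHs]; rewrite ?big_nil ?ltxx // !big_cons.
  set A := \sum_(j <- s) a j in IHs *; set v := \sum_(j <- s) _ in IHs *.
  have A0 : 0 <= A by apply: sumr_ge0.
  have [Az|An] := eqVneq A 0.
    have -> : v = 0.
      move/eqP: Az; rewrite /A psumr_eq0 // => /allP az; rewrite /v big_seq big1 // => j js.
      by rewrite (eqP (az j js)) scale0r.
    by rewrite Az !addr0 => ai; rewrite scalerK ?gt_eqF //; apply: SC.
  have {A0 An} A0 : 0 < A by rewrite lt_neqAle eq_sym An.
  move=> iA; have Ct : 0 <= a i / (a i + A) <= 1.
    by rewrite divr_ge0 ?(ltW iA) //= ler_pdivrMr // mul1r lerDl ltW.
  have := cC _ _ _ Ct (SC _ (Sx i)) (IHs A0).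
  congr C; rewrite scalerDr !scalerA mulrC; congr (_ + _ *: _).
  by field; rewrite !gt_eqF.
have := H (index_enum T); rewrite a1 invr1 scale1r; apply; exact: ltr01.
Qed.

Definition convex_combination X (p : V) (T : finType) : Prop :=
  exists (a : T -> R) (x : T -> V),
    [/\ forall i, 0 <= a i, \sum_i a i = 1, forall i, X (x i)
      & p = \sum_i a i *: x i].

Lemma conv_hull_combination X p :
  conv_hull X p -> exists T, convex_combination X p T.
Proof.
apply: (@smallest_sub _ _ X [set p | exists T, convex_combination X p T]); last first.
  move=> x Xx /=; exists unit, (fun=> 1), (fun=> x); split=> //.
    by rewrite sumr_const card_unit.
  by rewrite sumr_const card_unit scale1r.
apply/convex_setP => x y t /andP[t0 t1] /= [T [a [u [a0 a1 Xu ->]]]].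
move=> [T' [b [v [b0 b1 Xv ->]]]].
exists (T + T')%type.
exists (fun i => match i with inl i => t * a i | inr i => (1 - t) * b i end).
exists (fun i => match i with inl i => u i | inr i => v i end).
split=> [[i|i]||[i|i]|] //=; try by rewrite mulr_ge0 ?subr_ge0.
  by rewrite big_sumType /= -!mulr_sumr a1 b1; ring.
by rewrite big_sumType /= !scaler_sumr; congr (_ + _);
  apply: eq_bigr => i _; rewrite scalerA.
Qed.

End ConvexHull.

(** * Short convex combinations and balanced families *)

Lemma caratheodory (R : realType) d (X : set 'cV[R]_d) p :
  conv_hull X p -> convex_combination X p 'I_d.+1.
Proof.
move=> /conv_hull_combination[T [a [x [a0 a1 Xx ->]]]].
set q := \sum_i _.
have : exists m, convex_combination X q 'I_m.
  exists #|T|, (a \o enum_val), (x \o enum_val); split=> [i|||] //=.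
    rewrite -a1 (reindex _ (onW_bij _ (@enum_rank_bij T))) /=.
    by apply: eq_bigr => i _; rewrite enum_rankK.
  rewrite (reindex _ (onW_bij _ (@enum_rank_bij T))) /=.
  by apply: eq_bigr => i _; rewrite enum_rankK.
case=> {a0 a1 Xx} m; move: q => q {T a x}.
have pad n : convex_combination X q 'I_n -> convex_combination X q 'I_n.+1.
  case: n => [[a [x [_]]]|n [a [x [a0 a1 Xx ->]]]].
    by rewrite big_ord0 => /esym/eqP; rewrite oner_eq0.
  exists (fun i => if unlift ord0 i is Some j then a j else 0).
  exists (fun i => if unlift ord0 i is Some j then x j else x ord0).
  split=> [i||i|]; try by case: (unlift ord0 i).
    by rewrite big_ord_recl unlift_none add0r -a1; apply: eq_bigr => i _; rewrite liftK.
  rewrite [RHS]big_ord_recl unlift_none scale0r add0r.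
  by apply: eq_bigr => i _; rewrite liftK.
have reduce n : (d.+1 < n)%N ->
    convex_combination X q 'I_n -> convex_combination X q 'I_n.-1.
  case: n => // n dn [a [x [a0 a1 Xx qE]]] /=.
  (* The column of ones makes a kernel vector an affine dependence: its entries sum to 0. *)
  pose M : 'M[R]_(n.+1, d + 1) := row_mx (\matrix_i (x i)^T) (const_mx 1).
  have /rowV0Pn[u /sub_kermxP] : kermx M != 0.
    rewrite -mxrank_eq0 mxrank_ker subn_eq0 -ltnNge.
    by apply: leq_ltn_trans (rank_leq_col M) _; rewrite addn1.
  rewrite mul_mx_row => /eqP; rewrite row_mx_eq0 => /andP[/eqP ux /eqP us] u0.
  have {us} us : \sum_i u 0 i = 0.
    have /rowP/(_ 0) := us; rewrite !mxE => us0; rewrite -[RHS]us0.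
    by apply: eq_bigr => i _; rewrite mxE mulr1.
  have {ux} ux : \sum_i u 0 i *: x i = 0.
    apply/colP=> j; rewrite summxE [RHS]mxE.
    have /rowP/(_ j) := ux; rewrite mxE [_ 0 j]mxE => ux0; rewrite -[RHS]ux0.
    by apply: eq_bigr => i _; rewrite !mxE.
  have [i1 ui1] : exists i, 0 < u 0 i.
    apply/existsP; apply: contraNT u0 => /existsPn h.
    have h' i : u 0 i <= 0 by rewrite leNgt.
    apply/eqP/rowP=> i; rewrite mxE; apply/eqP; rewrite -oppr_eq0.
    have /eqP : \sum_i - u 0 i = 0 by rewrite sumrN us oppr0.
    rewrite psumr_eq0 => [/allP/(_ i)|j _]; last by rewrite oppr_ge0.
    by apply; rewrite mem_index_enum.
  pose i0 := [arg min_(i < i1 | 0 < u 0 i) (a i / u 0 i)]%O.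
  have [ui0 imin] : 0 < u 0 i0 /\ forall i, 0 < u 0 i -> a i0 / u 0 i0 <= a i / u 0 i.
    by rewrite /i0; case: arg_minP.
  (* The largest step along the dependence that keeps the weights nonnegative; it cancels the weight
     of [i0]. *)
  pose t := a i0 / u 0 i0; pose a' i := a i - t * u 0 i.
  have t0 : 0 <= t by rewrite divr_ge0 // ltW.
  have a'0 i : 0 <= a' i.
    rewrite subr_ge0; have [ui|ui] := ltP 0 (u 0 i).
      by rewrite -ler_pdivlMr //; apply: imin.
    by apply: le_trans (a0 i); rewrite mulr_ge0_le0.
  have a'i0 : a' i0 = 0 by rewrite /a' /t divfK ?gt_eqF // subrr.
  exists (a' \o lift i0), (x \o lift i0); split=> [i|||] //=.
    have : \sum_i a' i = 1 by rewrite /a' sumrB -mulr_sumr us mulr0 subr0.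
    by rewrite (bigD1_ord i0) //= a'i0 add0r.
  have : q = \sum_i a' i *: x i.
    under eq_bigr do rewrite /a' scalerBl -scalerA.
    by rewrite sumrB -scaler_sumr ux scaler0 subr0.
  by rewrite (bigD1_ord i0) //= a'i0 scale0r add0r.
have [le|lt] := leqP m d.+1.
  rewrite -(subnKC le); elim: (d.+1 - m)%N => [|k IHk]; first by rewrite addn0.
  by move/IHk/pad; rewrite addnS.
rewrite -(subnKC (ltnW lt)); elim: (m - d.+1)%N => [|k IHk]; first by rewrite addn0.
by rewrite addnS => /reduce/=; rewrite ltnS leq_addr => /(_ isT)/IHk.
Qed.

(** The index (c, s, m) stands for the m-th term in the expression of A e_c if [s] is true, of - A
    e_c otherwise. These opposite points cancel in the sum. *)
Lemma balanced_family (R : realType) d (X : set 'cV[R]_d) (A : 'M[R]_d) :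
  [set A *m x | x in @l2ball R d] `<=` conv_hull X ->
  exists (a : 'I_d * bool * 'I_d.+1 -> R) (x : 'I_d * bool * 'I_d.+1 -> 'cV[R]_d),
    [/\ forall k, 0 <= a k <= 1, forall k, X (x k), \sum_k a k *: x k = 0
      & forall c, col c A = \sum_m a (c, true, m) *: x (c, true, m)].
Proof.
move=> AX.
have hull c (s : bool) : conv_hull X ((-1) ^+ (~~ s) *: col c A : 'cV[R]_d).
  apply: AX; exists ((-1) ^+ (~~ s) *: delta_mx c 0); last by rewrite -scalemxAr -colE.
  rewrite /l2ball /l2norm /= (bigD1 c) //= !mxE !eqxx mulr1 sqrr_sign big1 => [|i ic].
    by rewrite addr0 sqrtr1.
  by rewrite !mxE (negbTE ic) mulr0 expr0n.
have comb (cs : 'I_d * bool) : exists ax : ('I_d.+1 -> R) * ('I_d.+1 -> 'cV[R]_d),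
    [/\ forall i, 0 <= ax.1 i, \sum_i ax.1 i = 1, forall i, X (ax.2 i)
      & (-1) ^+ (~~ cs.2) *: col cs.1 A = \sum_i ax.1 i *: ax.2 i].
  by have /caratheodory[a [x h]] := hull cs.1 cs.2; exists (a, x).
have [f hf] := choice comb.
exists (fun k => (f k.1).1 k.2), (fun k => (f k.1).2 k.2); split=> [k|k||c].
- have [a0 a1 _ _] := hf k.1; rewrite a0 /= -a1 (bigD1 k.2) //= lerDl.
  by rewrite sumr_ge0.
- by have [] := hf k.1.
- rewrite -(pair_bigA _ (fun cs m => (f cs).1 m *: (f cs).2 m)) /=.
  rewrite (eq_bigr (fun cs => (-1) ^+ (~~ cs.2) *: col cs.1 A)); last first.
    by move=> cs _; have [_ _ _ ->] := hf cs.
  rewrite -(pair_bigA _ (fun c s => (-1) ^+ (~~ s) *: col c A)) /= big1 // => c _.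
  by rewrite big_bool /= scale1r scaleN1r subrr.
- by have [_ _ _] := hf (c, true); rewrite /= scale1r.
Qed.

(** Adding [s] times the relation [dep] does not move a point of the ellipsoid, and makes its
    coefficients nonnegative with sum 1. *)
Lemma ellipsoid_in_hull (R : realType) d (S : set 'cV[R]_d)
    (a b l : 'I_d -> R) (x z : 'I_d -> 'cV[R]_d) (L rho : R) :
  (forall j, 0 <= a j <= 1) -> (forall i, 0 <= b i <= 1) ->
  (forall i, 0 <= l i <= L) -> 0 < \sum_j a j ->
  (forall j, S (x j)) -> (forall i, S (z i)) ->
  \sum_j a j *: x j + \sum_i l i *: (b i *: z i) = 0 ->
  0 < rho -> rho * (2 * d%:R + d%:R * L) <= 1 ->
  [set (rho *: \matrix_(i, j) (a j *: x j) i 0) *m u | u in @l2ball R d] `<=` conv_hull S.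
Proof.
move=> a01 b01 l0L sa Sx Sz dep rho0 rho1 _ [u ub <-].
have {}ub j : `|u j 0| <= 1.
  have su : 0 <= \sum_(i < d) u i 0 ^+ 2 by apply: sumr_ge0 => i _; rewrite sqr_ge0.
  have : \sum_(i < d) u i 0 ^+ 2 <= 1 by rewrite -ler_sqrt ?ler01 ?ltr01 // sqrtr1.
  rewrite (bigD1 j) //= => h; rewrite -(@ler_pXn2r _ 2) ?nnegrE // expr1n real_normK ?num_real //.
  by apply: le_trans h; rewrite lerDl sumr_ge0 // => i _; rewrite sqr_ge0.
pose D := \sum_j a j + \sum_i l i * b i.
have lb0 i : 0 <= l i * b i by have /andP[? _] := l0L i; have /andP[? _] := b01 i; rewrite mulr_ge0.
have D0 : 0 < D by rewrite ltr_pwDl // sumr_ge0.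
have DL : D <= d%:R + d%:R * L.
  have sumC (c : R) : d%:R * c = \sum_(i < d) c by rewrite sumr_const card_ord mulr_natl.
  rewrite -[X in X + _]mulr1 !sumC lerD // ler_sum // => i _; first by have /andP[] := a01 i.
  have /andP[l0 lL] := l0L i; have /andP[b0 b1] := b01 i.
  by rewrite -[L]mulr1 ler_pM.
(* Solves the equation that the coefficients sum to 1, [D] being the total weight of the relation;
   [rho <= s] then gives [0 <= rho * u j 0 + s]. *)
pose s := (1 - rho * \sum_j u j 0 * a j) / D.
have sumu : \sum_j u j 0 * a j <= d%:R.
  have -> : d%:R = \sum_(i < d) 1 :> R by rewrite sumr_const card_ord.
  apply: ler_sum => j _; have /andP[a0 a1] := a01 j.
  have := ub j; rewrite ler_norml => /andP[_ u1]; nra.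
have rs : rho <= s.
  rewrite /s ler_pdivlMr // lerBrDr -mulrDr; apply: le_trans rho1.
  by rewrite ler_pM2l //; lra.
have -> : (rho *: \matrix_(i, j) (a j *: x j) i 0) *m u =
    \sum_(c : 'I_d + 'I_d)
      (match c with inl j => (rho * u j 0 + s) * a j | inr i => s * (l i * b i) end) *:
      (match c with inl j => x j | inr i => z i end).
  rewrite big_sumType /=.
  have -> : \sum_i (s * (l i * b i)) *: z i = s *: \sum_i l i *: (b i *: z i).
    by rewrite scaler_sumr; apply: eq_bigr => i _; rewrite !scalerA mulrA.
  have -> : \sum_i l i *: (b i *: z i) = - \sum_j a j *: x j.
    by apply/eqP; rewrite -addr_eq0 addrC dep.
  rewrite scalerN scaler_sumr -sumrB; apply/colP=> i; rewrite mxE summxE.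
  by apply: eq_bigr => j _; rewrite !mxE; ring.
apply: conv_hull_comb => [[j|i]||[j|i]] //.
- have /andP[a0 _] := a01 j; rewrite mulr_ge0 //.
  have := ub j; rewrite ler_norml => /andP[u1 _]; nra.
- by rewrite mulr_ge0 // (le_trans (ltW rho0)).
- rewrite big_sumType /= -mulr_sumr.
  under eq_bigr do rewrite mulrDl -mulrA.
  rewrite big_split /= -!mulr_sumr -addrA -mulrDr -/D /s divfK ?gt_eqF //.
  by rewrite addrC subrK.
Qed.

(** * The rainbow ellipsoid *)

(* With n = 2 d (d + 1) vectors in each balanced family, the ellipsoid is the image
   of the ball under rho W, where 1 / rho = 2 d + d (d n^d). *)
Definition inv_det_bound (d : nat) : nat :=
  ((2 * d + d * (d * (d * 2 * d.+1) ^ d)) ^ d * (d`! * d.+1 ^ d))%N.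

Lemma inv_det_bound_gt0 d : (0 < d)%N -> (0 < inv_det_bound d)%N.
Proof.
by move=> d0; rewrite /inv_det_bound !(muln_gt0, expn_gt0, addn_gt0) d0 fact_gt0.
Qed.

Lemma fact_leq_exp d : (d`! <= d ^ d)%N.
Proof.
elim: d => // d IHd; rewrite factS expnS leq_mul2l /=.
by case: d IHd => // d /leq_trans; apply; rewrite leq_exp2r.
Qed.

(** The factors are at most d^(d(4d+3)), d^d and d^(2d), and 4d^2 + 6d <= 7d^2 from d = 2 on. *)
Lemma inv_det_bound_leq d : (2 <= d)%N -> (inv_det_bound d <= d ^ (7 * d ^ 2))%N.
Proof.
move=> d2; have d0 : (0 < d)%N by apply: ltnW.
have dd : (d.+1 <= d ^ 2)%N by rewrite expnS expn1; nia.
have h1 : ((d * 2 * d.+1) ^ d <= d ^ (4 * d))%N.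
  rewrite expnM leq_exp2r // (expnD d 2 2) leq_mul // expnS expn1 leq_mul2l.
  by rewrite d2 orbT.
have h2 : (2 * d + d * (d * (d * 2 * d.+1) ^ d) <= d ^ (4 * d + 3))%N.
  have h3 : (d * (d * (d * 2 * d.+1) ^ d) <= d ^ (4 * d + 2))%N.
    by rewrite addn2 !expnS !leq_mul2l h1 !orbT.
  have h4 : (2 * d <= d ^ (4 * d + 2))%N.
    apply: leq_trans (_ : d ^ 2 <= _)%N; first by rewrite expnS expn1 leq_mul2r d2 orbT.
    by rewrite leq_exp2l // leq_addl.
  by rewrite (addnS _ 2) expnS; nia.
apply: leq_trans (_ : (d ^ (4 * d + 3)) ^ d * (d ^ d * (d ^ 2) ^ d) <= _)%N.
  rewrite leq_mul //; first by rewrite leq_exp2r.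
  by rewrite leq_mul ?fact_leq_exp // leq_exp2r.
by rewrite -!expnM -!expnD leq_exp2l //; nia.
Qed.

Theorem rainbow_ellipsoid (R : realType) d (X : 'I_(2 * d.+1)%N -> set 'cV[R]_d.+1) :
  (forall i, exists Ai : 'M[R]_d.+1,
    [/\ Ai \in unitmx, [set Ai *m x | x in @l2ball R d.+1] `<=` conv_hull (X i)
      & 1 <= `|\det Ai|]) ->
  exists (S : set 'cV[R]_d.+1) (A : 'M[R]_d.+1),
    [/\ rainbow X S, A \in unitmx, [set A *m x | x in @l2ball R d.+1] `<=` conv_hull S
      & (inv_det_bound d.+1)%:R^-1 <= `|\det A|].
Proof.
set D := d.+1 => hX.
have [A hA] := choice hX.
pose K := ('I_D * bool * 'I_D.+1)%type.
have [a ha] := choice (fun i => let: And3 _ h _ := hA i in balanced_family h).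
have [x hx] := choice ha.
pose y c (k : K) : 'rV[R]_D := (a c k *: x c k)^T.
have y0 c : \sum_k y c k = 0.
  by have [_ _ /(congr1 trmx) h _] := hx c; rewrite raddf_sum trmx0 in h.
have yA c r : row r (A c)^T = \sum_m y c (r, true, m).
  by have [_ _ _ h] := hx c; rewrite -tr_col h raddf_sum.
pose C := 'I_(2 * D)%N.
pose V (tk : {ffun 'I_D -> C} * {ffun 'I_D -> K}) := \matrix_i y (tk.1 i) (tk.2 i).
have D_le : (D <= 2 * D)%N by rewrite leq_pmull.
pose tk0 : {ffun 'I_D -> C} * {ffun 'I_D -> K} :=
  ([ffun i => widen_ord D_le i], [ffun=> (ord0, true, ord0)]).
have tk0_inj : injectiveb tk0.1.
  by apply/injectiveP=> i j; rewrite !ffunE => /(congr1 val)/= /val_inj.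
pose tk := [arg max_(tk > tk0 | injectiveb tk.1) `|\det (V tk)|]%O.
have [/injectiveP t_inj Vmax] : injectiveb tk.1 /\
    forall tk' : {ffun 'I_D -> C} * {ffun 'I_D -> K}, injectiveb tk'.1 -> `|\det (V tk')| <= `|\det (V tk)|.
  by rewrite /tk; case: arg_maxP.
case: tk t_inj Vmax => t k /= t_inj Vmax.
have card_J : #|~: [set t i | i in 'I_D]| = D.
  by rewrite cardsCs finset.setCK card_imset // !card_ord mul2n -addnn addnK.
(* Enumerates the D colours that [t] leaves free. *)
pose u (j : 'I_D) : C := enum_val (cast_ord (esym card_J) j).
have u_inj : injective u by move=> i j /enum_val_inj/cast_ord_inj.
have tu i j : t i != u j.
  have := enum_valP (cast_ord (esym card_J) j); rewrite -/(u j) inE.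
  by apply: contraNneq => <-; apply: imset_f.
(* One column from each [A (u j)], then, by multilinearity, one term of each column: this costs D!
   and (D+1)^D. *)
have [k' hk'] : exists k' : 'I_D -> 'I_D,
    1 <= D`!%:R * `|\det (\matrix_j row (k' j) (A (u j))^T)|.
  by apply: rainbow_rows => // j; rewrite det_tr; have [] := hA (u j).
have fact0 : 0 < D`!%:R :> R by rewrite ltr0n fact_gt0.
have [m hm] : exists m : {ffun 'I_D -> 'I_D.+1}, D`!%:R^-1 <=
    #|{ffun 'I_D -> 'I_D.+1}|%:R * `|\det (\matrix_j y (u j) (k' j, true, m j))|.
  apply: (det_sum_rows_pick (y := fun j m => y (u j) (k' j, true, m))); rewrite ?invr_gt0 // -(ler_pM2l fact0) divff ?gt_eqF //.
  apply: le_trans hk' _; rewrite le_eqVlt; apply/orP; left; apply/eqP.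
  by congr (_ * `|\det _|); apply/matrixP=> i j; rewrite [RHS]mxE -yA !mxE.
pose kw j : K := (k' j, true, m j).
pose W := \matrix_j y (u j) (kw j).
have W_ge : (D`! * D.+1 ^ D)%:R^-1 <= `|\det W|.
  rewrite natrM invfM ler_pdivrMr ?ltr0n ?expn_gt0 //.
  by move: hm; rewrite card_ffun !card_ord mulrC.
have W0 : 0 < `|\det W|.
  by apply: lt_le_trans W_ge; rewrite invr_gt0 ltr0n muln_gt0 fact_gt0 expn_gt0.
(* [W] competes with [V] in the maximum, so [V] is nondegenerate. *)
have V0 : \det (\matrix_i y (t i) (k i)) != 0.
  rewrite -normr_gt0; apply: lt_le_trans W0 _.
  have := Vmax ([ffun j => u j], [ffun j => kw j]).
  have -> : V ([ffun j => u j], [ffun j => kw j]) = W.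
    by apply/matrixP=> i j; rewrite !mxE !ffunE.
  by apply; apply/injectiveP=> i j; rewrite !ffunE => /u_inj.
have [v [l [Vv v0 l0 dep]]] :=
  balanced_cone (fun i => y0 (t i)) (- \sum_j y (u j) (kw j)) V0.
set M := \matrix_i y (t i) (v i) in v0 Vv dep.
have cardK : #|{ffun 'I_D -> K}| = ((D * 2 * D.+1) ^ D)%N.
  by rewrite card_ffun !card_prod card_bool !card_ord.
pose L : R := (D * (D * 2 * D.+1) ^ D)%:R.
have lL i : l 0 i <= L.
  (* Replacing colour [t i] by [u j] keeps the colours distinct, so maximality bounds each
     determinant of Cramer's rule for [l 0 i]. *)
  have swap j : `|\det (set_row i (y (u j) (kw j)) M)| <= `|\det (\matrix_i y (t i) (k i))|.
    have := Vmax ([ffun r => if r == i then u j else t r],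
                  [ffun r => if r == i then kw j else v r]).
    have -> : V ([ffun r => if r == i then u j else t r],
                 [ffun r => if r == i then kw j else v r]) =
        set_row i (y (u j) (kw j)) M.
      by apply/matrixP=> r s; rewrite !mxE !ffunE; case: eqP.
    apply; apply/injectiveP=> r s; rewrite !ffunE.
    case: eqP => [->|_]; case: eqP => [->|_] //; last exact: t_inj.
      by move/esym/eqP; rewrite (negbTE (tu _ _)).
    by move/eqP; rewrite (negbTE (tu _ _)).
  rewrite -(ler_pM2r (_ : 0 < `|\det M|)) ?normr_gt0 //.
  rewrite -{1}(ger0_norm (l0 i)) -normrM -det_set_row_mul -dep det_set_row mulNmx mxE normrN.
  rewrite mulmx_suml summxE (le_trans (ler_norm_sum _ _ _)) //.
  apply: le_trans (_ : \sum_(j < D) `|\det (\matrix_i y (t i) (k i))| <= _).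
    by apply: ler_sum => j _; rewrite -det_set_row.
  rewrite sumr_const card_ord -[X in X <= _]mulr_natl /L natrM -mulrA ler_pM2l ?ltr0n //.
  by rewrite -cardK.
pose rho : R := (2 * D%:R + D%:R * L)^-1.
have den0 : 0 < 2 * D%:R + D%:R * L by rewrite ltr_pwDl ?mulr_gt0 ?ltr0n // mulr_ge0.
have rho0 : 0 < rho by rewrite invr_gt0.
have a01 c q : 0 <= a c q <= 1 by have [] := hx c.
have Xx c q : X c (x c q) by have [] := hx c.
(* The images of [t] and [u] partition the colours, so [v] and [kw] glue to one index per colour. *)
pose kk c : K := if [pick i | t i == c] is Some i then v i
  else if [pick j | u j == c] is Some j then kw j else (ord0, true, ord0).
have kt i : kk (t i) = v i.
  by rewrite /kk; case: pickP => [i' /eqP/t_inj->//|/(_ i)]; rewrite eqxx.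
have ku j : kk (u j) = kw j.
  rewrite /kk; case: pickP => [i'|_]; first by rewrite (negbTE (tu _ _)).
  by case: pickP => [j' /eqP/u_inj->//|/(_ j)]; rewrite eqxx.
pose S := [set x c (kk c) | c in [set: C]].
pose W' : 'M[R]_D := \matrix_(i, j) (a (u j) (kw j) *: x (u j) (kw j)) i 0.
have detW' : \det (rho *: W') = rho ^+ D * \det W.
  rewrite detZ -(det_tr W); congr (_ * \det _).
  by apply/matrixP=> i j; rewrite !mxE.
exists S, (rho *: W'); split.
- by exists [set: C], (fun c => x c (kk c)); split.
- by rewrite unitmxE detW' unitfE -normr_gt0 normrM mulr_gt0 // normr_gt0 expf_neq0 ?gt_eqF.
- apply: (ellipsoid_in_hull (b := fun i => a (t i) (v i)) (l := l 0)
    (z := fun i => x (t i) (v i)) (L := L)) => //.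
  + by move=> i; rewrite l0 lL.
  + rewrite lt_neqAle eq_sym sumr_ge0 ?andbT => [|j _]; last by have /andP[] := a01 (u j) (kw j).
    apply: contraTneq W0 => /eqP; rewrite psumr_eq0 => [/allP az|j _]; last first.
      by have /andP[] := a01 (u j) (kw j).
    have -> : W = 0.
      apply/matrixP=> i j; rewrite !mxE.
      by have /eqP-> := az i (mem_index_enum _); rewrite mul0r.
    by rewrite det0 normr0 ltxx.
  + by move=> j; exists (u j); rewrite ?ku.
  + by move=> i; exists (t i); rewrite ?kt.
  + apply: trmx_inj; rewrite raddfD /= !raddf_sum /= trmx0.
    have -> : \sum_i (l 0 i *: (a (t i) (v i) *: x (t i) (v i)))^T = l *m M.
      rewrite mulmx_sum_row; apply: eq_bigr => i _.
      by rewrite linearZ /= /M; congr (_ *: _); apply/rowP=> r; rewrite !mxE.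
    by rewrite -dep subrr.
  + by rewrite mulVf ?gt_eqF.
- rewrite detW' normrM normrX gtr0_norm // /inv_det_bound natrM invfM.
  have -> : rho ^+ D = ((2 * D + D * (D * (D * 2 * D.+1) ^ D)) ^ D)%:R^-1.
    by rewrite /rho /L exprVn natrX natrD !natrM.
  by rewrite ler_wpM2l // invr_ge0.
Qed.

Theorem theorem1p2 (R : realType) :
  exists (c : R) (cd : nat -> R),
    [/\ 0 < c,
        (forall d : nat, (1 <= d)%N -> 0 < cd d),
        (forall d : nat, (2 <= d)%N ->
           cd d = d%:R `^ (- (c * d%:R ^+ 2)))
      & (forall d : nat, (1 <= d)%N ->
           forall X : 'I_(2 * d)%N -> set 'cV[R]_d,
             (forall i : 'I_(2 * d)%N, exists Ai : 'M[R]_d,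
                [/\ Ai \in unitmx,
                    [set Ai *m x | x in @l2ball R d] `<=` conv_hull (X i)
                  & 1 <= `|\det Ai|]) ->
             exists (S : set 'cV[R]_d) (A : 'M[R]_d),
               [/\ rainbow X S,
                   A \in unitmx,
                   [set A *m x | x in @l2ball R d] `<=` conv_hull S
                 & cd d <= `|\det A|])].
Proof.
(* In dimension 1 the power would be 1, more than is proved, so [inv_det_bound] itself is used
   there. *)
pose cd d : R := if (2 <= d)%N then d%:R `^ (- (7%:R * d%:R ^+ 2))
                 else (inv_det_bound d)%:R^-1.
exists 7%:R, cd; split=> [|d d1|d d2|[//|d] _ X /rainbow_ellipsoid[S [A [rS uA AS hA]]]].
- by rewrite ltr0n.
- rewrite /cd; case: ifP => _; first by rewrite powR_gt0 ?ltr0n.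
  by rewrite invr_gt0 ltr0n inv_det_bound_gt0.
- by rewrite /cd d2.
exists S, A; split=> //; apply: le_trans hA.
rewrite /cd; case: ifP => // d2.
rewrite powRN -natrX -natrM powR_mulrn // -natrX lef_pV2 ?posrE ?ltr0n ?expn_gt0 //.
  by rewrite ler_nat inv_det_bound_leq.
exact: inv_det_bound_gt0.
Qed.
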